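(* Let $f:\mathbb{R}^d\to\mathbb{R}$ be convex and continuously differentiable with $L$-Lipschitz continuous gradient $\nabla f$ ($L>0$), let $g:\mathbb{R}^d\to\mathbb{R}\cup\{+\infty\}$ be convex, proper and lower semicontinuous, let $\lambda>0$, and assume that $F_\lambda = f+\lambda g$ admits at least one minimum point in $\mathbb{R}^d$. Let $(\lambda_n)_{n\in\mathbb{N}}$ be a sequence of strictly positive real numbers such that $$\sum_{n=0}^{\infty}|\lambda_n-\lambda|<\infty,$$ and let $\alpha\in(0,2/L)$. Let $u_0\in\mathbb{R}^d$ be arbitrary and define $$u_{n+1}=\operatorname{prox}_{\alpha\lambda_n g}\bigl(u_n-\alpha\nabla f(u_n)\bigr),\qquad n=0,1,2,\ldots$$ Then the sequence $(u_n)_{n\in\mathbb{N}}$ converges to a solution $\hat u\in\mathbb{R}^d$ of the problem $\min_{u\in\mathbb{R}^d} F_\lambda(u)$, i.e. to a minimizer of $F_\lambda$.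
   Context: For a convex, proper, lower semicontinuous function $g:\mathbb{R}^d\to\mathbb{R}\cup\{+\infty\}$ and $\beta>0$, the proximal mapping is $\operatorname{prox}_{\beta g}(a)=\operatorname{arg\,min}_{u\in\mathbb{R}^d}\frac12\|u-a\|_2^2+\beta g(u)$ (the minimizer exists and is unique). $\mathbb{R}^d$ carries the Euclidean norm. *)

(* Defs.v *)
(* Library: MathComp-Analysis, over an arbitrary R : realType. *)
From HB Require Import structures.
From mathcomp Require Import all_boot all_order all_algebra.
From mathcomp Require Import all_classical all_reals all_analysis.

Set Implicit Arguments.
Unset Strict Implicit.
Unset Printing Implicit Defensive.

Import Order.TTheory GRing.Theory Num.Theory.
Import numFieldNormedType.Exports.

Local Open Scope classical_set_scope.
Local Open Scope ring_scope.

(* The norm `|_| that the library puts on 'rV[R]_d is the sup norm. The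
   topology and the derivative on 'rV[R]_d do not depend on the choice of norm,
   but the Lipschitz constant and the proximal map do, and they are stated with
   this one. *)
Definition enorm (R : realType) (d : nat) (u : 'rV[R]_d) : R :=
  Num.sqrt (\sum_(i < d) u ord0 i ^+ 2).

Definition gradient (R : realType) (d : nat) (f : 'rV[R]_d -> R)
    (x : 'rV[R]_d) : 'rV[R]_d :=
  \row_(i < d) 'D_(delta_mx ord0 i) f x.

Definition continuously_differentiable (R : realType) (d : nat)
    (f : 'rV[R]_d -> R) : Prop :=
  (forall x, differentiable f x) /\ continuous (gradient f).

Definition elipschitz (R : realType) (d : nat) (L : R)
    (h : 'rV[R]_d -> 'rV[R]_d) : Prop :=
  forall x y, enorm (h x - h y) <= L * enorm (x - y).

(* At t = 0 and t = 1 the convention 0 * +oo = 0 makes this an equality, also where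
   g is infinite. *)
Definition econvex (R : realType) (d : nat) (g : 'rV[R]_d -> \bar R) : Prop :=
  forall (t : {i01 R}) (x y : 'rV[R]_d),
    (g ((t%:num *: x + (1 - t%:num) *: y)%R)
      <= t%:num%:E * g x + (1 - t%:num)%:E * g y)%E.

Definition proper_function (R : realType) (d : nat)
    (g : 'rV[R]_d -> \bar R) : Prop :=
  (forall u, g u != -oo%E) /\ (exists u, g u != +oo%E).

Definition argmin (R : realType) (d : nat) (h : 'rV[R]_d -> \bar R) :
    set 'rV[R]_d :=
  [set u | forall v, (h u <= h v)%E].

(* [get] selects an element of the set, and an arbitrary vector if the set is
   empty; for g convex, proper, lower semicontinuous and beta > 0 the set is a
   singleton. *)
Definition prox (R : realType) (d : nat) (beta : R) (g : 'rV[R]_d -> \bar R)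
    (a : 'rV[R]_d) : 'rV[R]_d :=
  get (argmin (fun u => (2^-1 * enorm (u - a) ^+ 2)%:E + beta%:E * g u)%E).

Definition objective (R : realType) (d : nat) (f : 'rV[R]_d -> R)
    (g : 'rV[R]_d -> \bar R) (lambda : R) (u : 'rV[R]_d) : \bar R :=
  ((f u)%:E + lambda%:E * g u)%E.

(* Main.v *)
(* Write e_n = (lambda_n / lambda - 1) alpha grad f(p) for a minimizer p. Adding the
   optimality condition of the prox step at n to that of p rescaled by lambda_n / lambda
   gives <u_n - u_{n+1} - alpha (grad f(u_n) - grad f(p)) + e_n, u_{n+1} - p> >= 0, and e_n
   is summable and independent of the iterates. By cocoercivity of the gradient,
   |u_{n+1} - p| <= |u_n - p| + |e_n|, so |u_n - p| converges, and the squared version of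
   the estimate forces u_{n+1} - u_n -> 0. Hence the limit q of any convergent
   subsequence of the bounded sequence u satisfies the limiting prox optimality
   condition, i.e. q is a minimizer; applying the first estimate with p = q, |u_n - q|
   converges, and its limit is 0 along the subsequence. *)

Require Import Defs.
From HB Require Import structures.
From mathcomp Require Import all_boot all_order all_algebra.
From mathcomp Require Import all_classical all_reals all_analysis.
From mathcomp Require Import ring lra.

Import Order.TTheory GRing.Theory Num.Theory.
Import numFieldNormedType.Exports.

Local Open Scope classical_set_scope.
Local Open Scope ring_scope.

(** * Euclidean structure *)

Definition dot {R : realType} {d : nat} (x y : 'rV[R]_d) : R :=
  \sum_(i < d) x ord0 i * y ord0 i.

Section Dot.
Context {R : realType} {d : nat}.
Implicit Types x y z : 'rV[R]_d.

Lemma dotC x y : dot x y = dot y x.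
Proof. by apply: eq_bigr => i _; rewrite mulrC. Qed.

Lemma dotDl x y z : dot (x + y) z = dot x z + dot y z.
Proof. by rewrite -big_split; apply: eq_bigr => i _; rewrite mxE mulrDl. Qed.

Lemma dotZl (a : R) x y : dot (a *: x) y = a * dot x y.
Proof. by rewrite mulr_sumr; apply: eq_bigr => i _; rewrite mxE mulrA. Qed.

Lemma dotNl x y : dot (- x) y = - dot x y.
Proof. by rewrite -scaleN1r dotZl mulN1r. Qed.

Lemma dotDr x y z : dot x (y + z) = dot x y + dot x z.
Proof. by rewrite ![dot x _]dotC dotDl. Qed.

Lemma dotZr (a : R) x y : dot x (a *: y) = a * dot x y.
Proof. by rewrite ![dot x _]dotC dotZl. Qed.

Lemma dotNr x y : dot x (- y) = - dot x y.
Proof. by rewrite ![dot x _]dotC dotNl. Qed.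

Definition dotE := (dotDl, dotDr, dotZl, dotZr, dotNl, dotNr).

Lemma dot_ge0 x : 0 <= dot x x.
Proof. by apply: sumr_ge0 => i _; rewrite -expr2 sqr_ge0. Qed.

Lemma enormE x : enorm x = Num.sqrt (dot x x).
Proof. by congr Num.sqrt; apply: eq_bigr => i _; rewrite expr2. Qed.

Lemma enorm_ge0 x : 0 <= enorm x.
Proof. exact: sqrtr_ge0. Qed.

Lemma sqr_enorm x : enorm x ^+ 2 = dot x x.
Proof. by rewrite enormE sqr_sqrtr// dot_ge0. Qed.

Lemma enormZ (a : R) x : enorm (a *: x) = `|a| * enorm x.
Proof. by rewrite !enormE !dotE mulrA -expr2 sqrtrM ?sqr_ge0// sqrtr_sqr. Qed.

Lemma enormB x y : enorm (x - y) = enorm (y - x).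
Proof. by rewrite -opprB -scaleN1r enormZ normrN1 mul1r. Qed.

Lemma coord_le_enorm x i : `|x ord0 i| <= enorm x.
Proof.
rewrite -sqrtr_sqr ler_wsqrtr// (bigD1 i)//= lerDl.
by apply: sumr_ge0 => j _; rewrite sqr_ge0.
Qed.

(** The bridge from Euclidean estimates to the sup norm, and hence to the topology that the library
    uses. *)
Lemma norm_le_enorm x : `|x| <= enorm x.
Proof.
rewrite [leLHS]mx_normrE; apply/bigmax_leP; split; first exact: enorm_ge0.
by move=> [i j] _ /=; rewrite ord1 coord_le_enorm.
Qed.

(** Cauchy-Schwarz: the square of [enorm y *: x - enorm x *: y] equals [2 * (enorm x * enorm y) *
    (enorm x * enorm y - dot x y)]. Zero vectors are split off because the first factor is divided
    out. *)
Lemma dot_le_enorm x y : dot x y <= enorm x * enorm y.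
Proof.
have [y0|y0] := eqVneq (enorm y) 0.
  have y_0 : y = 0.
    by apply/eqP; rewrite -normr_le0 -y0 norm_le_enorm.
  by rewrite y0 mulr0 y_0 -(scale0r 0) dotZr mul0r.
have y_gt0 : 0 < enorm y by rewrite lt_def y0 enorm_ge0.
have := dot_ge0 (enorm y *: x - enorm x *: y).
have : 0 <= enorm x by exact: enorm_ge0.
rewrite !dotE (dotC y x) -!sqr_enorm le_eqVlt => /predU1P[x0 _|x_gt0].
  have x_0 : x = 0.
    by apply/eqP; rewrite -normr_le0 x0 norm_le_enorm.
  by rewrite -x0 mul0r x_0 -(scale0r 0) dotZl mul0r.
rewrite (_ : _ + _ = 2 * (enorm x * enorm y) * (enorm x * enorm y - dot x y));
  last by ring.
by rewrite pmulr_rge0 ?subr_ge0// !mulr_gt0.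
Qed.

Lemma ler_enormD x y : enorm (x + y) <= enorm x + enorm y.
Proof.
rewrite -ler_sqr ?nnegrE ?addr_ge0 ?enorm_ge0// sqr_enorm !dotE (dotC y x).
by have := dot_le_enorm x y; rewrite -!sqr_enorm; nra.
Qed.

Lemma cvg_dot (T : Type) (F : set_system T) {FF : Filter F}
    (a b : T -> 'rV[R]_d) x y :
  a t @[t --> F] --> x -> b t @[t --> F] --> y ->
  dot (a t) (b t) @[t --> F] --> dot x y.
Proof.
move=> ax bY.
have coord (c : T -> 'rV[R]_d) z i : c t @[t --> F] --> z ->
    c t ord0 i @[t --> F] --> z ord0 i.
  move=> cz; apply: (cvg_comp c (fun M : 'rV[R]_d => M ord0 i) cz).
  exact: coord_continuous.
by apply: cvg_big => [|i _]; [exact: add_continuous|apply: cvgM; exact: coord].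
Qed.

End Dot.

(** * Smooth convex functions *)

Section Smooth.
Context {R : realType} {d : nat}.
Variables (f : 'rV[R]_d -> R) (L : R).
Hypothesis df : forall x, differentiable f x.
Hypothesis lip : elipschitz L (gradient f).
Implicit Types x y z h : 'rV[R]_d.

Lemma derive_gradient x h : 'D_h f x = dot (gradient f x) h.
Proof.
rewrite deriveE// {1}(row_sum_delta h) linear_sum; apply: eq_bigr => i _.
by rewrite linearZ /= -deriveE// mxE mulrC.
Qed.

(** The difference quotient of the restriction at [t] is literally that of [f] at [x + t *: h] in
    direction [h]. *)
Lemma is_derive_line x h (t : R) :
  is_derive t (1 : R) (fun s : R => f (x + s *: h))
    (dot (gradient f (x + t *: h)) h).
Proof.
have E : (fun k : R => k^-1 *:
      (((fun s : R => f (x + s *: h)) \o shift t) (k *: (1 : R))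
        - f (x + t *: h))) =
    (fun k : R => k^-1 *:
      ((f \o shift (x + t *: h)) (k *: h) - f (x + t *: h))).
  apply/funext => k /=; congr (_ *: (f _ - _)).
  by rewrite [k *: 1]mulr1 scalerDl addrCA.
have dd : derivable f (x + t *: h) h by exact: diff_derivable.
split; first by rewrite /derivable E.
by rewrite -derive_gradient /derive E.
Qed.

Lemma descent x h :
  f (x + h) <= f x + dot (gradient f x) h + L / 2 * dot h h.
Proof.
(* The claim is [psi 1 <= psi 0]. By the mean value theorem it suffices that [dpsi t <= 0] for
   [t > 0], which is Cauchy-Schwarz plus the Lipschitz bound. *)
pose psi (t : R) :=
  f (x + t *: h) - t * dot (gradient f x) h - L / 2 * dot h h * t ^+ 2.
pose dpsi (t : R) := dot (gradient f (x + t *: h)) h - dot (gradient f x) h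
  - L * dot h h * t.
have psi' (t : R) : is_derive t (1 : R) psi (dpsi t).
  have fl := is_derive_line x h t.
  rewrite /psi; apply: is_derive_eq.
  by rewrite /dpsi /GRing.scale /=; field.
have cpsi : {within `[0, 1], continuous psi}.
  apply: derivable_within_continuous => s _; by have [] := psi' s.
have [t t01] := MVT ltr01 (fun s _ => psi' s) cpsi.
rewrite subr0 mulr1 /psi scale0r addr0 mul0r subr0 expr0n/= mulr0 subr0.
rewrite scale1r mul1r expr1n mulr1.
have t0 : 0 < t by move: t01; rewrite in_itv/= => /andP[].
have : dpsi t <= 0.
  rewrite /dpsi -dotNl -dotDl.
  have := dot_le_enorm (gradient f (x + t *: h) - gradient f x) h.
  have := lip (x + t *: h) x; rewrite addrAC subrr add0r enormZ gtr0_norm//.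
  rewrite -sqr_enorm; have := enorm_ge0 h; nra.
lra.
Qed.

End Smooth.

(** Division by [t] and [t -> 0], in a limit-free form; it turns comparisons along a segment into
    first-order conditions. *)
Lemma ge0_of_quadratic {R : realFieldType} (a b : R) :
  (forall t, 0 < t -> t <= 1 -> 0 <= t * a + t ^+ 2 * b) -> 0 <= a.
Proof.
move=> H; rewrite leNgt; apply/negP => a0.
(* With [t = - a / c] one has [t <= 1] and [a + t * b <= - t * (1 - a) < 0], a contradiction. *)
pose c := `|b| + 1 - a.
have c0 : 0 < c by rewrite /c; have := normr_ge0 b; lra.
have t0 : 0 < - a / c by rewrite divr_gt0 ?oppr_gt0.
have t1 : - a / c <= 1 by rewrite ler_pdivrMr// /c; have := normr_ge0 b; lra.
have := H _ t0 t1; set t := - a / c in t0 t1 *.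
have tc : t * c = - a by rewrite /t divfK// gt_eqF.
have := ler_norm b; move: tc; rewrite /c; nra.
Qed.

(** * First-order inequality and cocoercivity for smooth convex functions *)

Section ConvexSmooth.
Context {R : realType} {d : nat}.
Variables (f : 'rV[R]_d -> R) (L : R).
Hypothesis f_convex : convex_function [set: 'rV[R]_d] f.
Hypothesis df : forall x, differentiable f x.
Hypothesis L_gt0 : 0 < L.
Hypothesis lip : elipschitz L (gradient f).
Implicit Types x y z h : 'rV[R]_d.

(** The descent lemma from [x + h] back to [x] costs [L / 2], and replacing the gradient at [x + h]
    by the one at [x] costs another [L]. *)
Lemma descent_lower x h :
  f x + dot (gradient f x) h - 3 / 2 * L * dot h h <= f (x + h).
Proof.
have := descent f L df lip (x + h) (- h); rewrite addrK !dotE.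
have := lip (x + h) x; rewrite addrAC subrr add0r => lipxh.
have := dot_le_enorm (gradient f x - gradient f (x + h)) h.
rewrite enormB !dotE -!sqr_enorm.
have := enorm_ge0 h; nra.
Qed.

(** At [x + t *: h], convexity bounds [f] above by the chord and [descent_lower] bounds it below up
    to a term in [t ^+ 2]. *)
Lemma gradient_le x h : f x + dot (gradient f x) h <= f (x + h).
Proof.
rewrite -subr_ge0; pose B := 3 / 2 * L * dot h h.
apply: (@ge0_of_quadratic _ _ B) => t t0 t1.
have : f (t *: (x + h) + (1 - t) *: x) <= t * f (x + h) + (1 - t) * f x.
  exact: f_convex (Itv01 (ltW t0) t1) (x + h) x (in_setT _) (in_setT _).
rewrite (_ : t *: _ + _ = x + t *: h); last first.
  by rewrite scalerDr addrAC -scalerDl [t + _]addrC subrK scale1r.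
have := descent_lower x (t *: h); rewrite !dotE /B.
nra.
Qed.

(* The descent lemma at [y] in the direction of [gradient f x - gradient f y],
   combined with [gradient_le] at the point it reaches. *)
Lemma gradient_le_sharp x y :
  f x + dot (gradient f x) (y - x)
    + (2 * L)^-1 * dot (gradient f y - gradient f x) (gradient f y - gradient f x)
  <= f y.
Proof.
have [k kE] : exists k, gradient f y = gradient f x + k.
  by exists (gradient f y - gradient f x); rewrite addrC subrK.
(* [k] is the gradient at [y] of [f] minus the linear form of [gradient f x]; the step [- L^-1]
   minimizes the quadratic upper bound. *)
have := descent f L df lip y (- L^-1 *: k).
have := gradient_le x (y - x - L^-1 *: k).
rewrite addrA [x + _]addrC subrK scaleNr kE => h1 h2.
rewrite (_ : _ + k - _ = k); last by rewrite addrAC subrr add0r.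
have := le_trans h1 h2; rewrite !dotE.
set K := dot k k.
have -> : L / 2 * - (L^-1 * - (L^-1 * K)) = (2 * L)^-1 * K.
  by field; rewrite gt_eqF.
have -> : L^-1 * K = 2 * ((2 * L)^-1 * K) by field; rewrite gt_eqF.
lra.
Qed.

(** Adding the two instances of [gradient_le_sharp] with [x] and [y] exchanged cancels the values of
    [f]. *)
Lemma gradient_cocoercive x y :
  L^-1 * dot (gradient f x - gradient f y) (gradient f x - gradient f y)
    <= dot (gradient f x - gradient f y) (x - y).
Proof.
have := gradient_le_sharp x y; have := gradient_le_sharp y x.
rewrite -[gradient f y - _]opprB -[y - x]opprB !dotE.
rewrite invfM; lra.
Qed.

End ConvexSmooth.

(** * Compactness and lower semicontinuity *)

(** Extracted indices are only known to satisfy [k <= s k], not to increase; this suffices to pass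
    to the limit along [s]. *)
Lemma cvg_infty_ge (s : nat -> nat) : (forall k, (k <= s k)%N) ->
  s k @[k --> \oo] --> \oo.
Proof.
move=> ks A [N _ NA]; exists N => // k /= Nk.
by apply: NA => /=; exact: leq_trans (ks k).
Qed.

(** Bolzano-Weierstrass: the sequence lies in a compact box, and indices are chosen within
    [k.+1%:R^-1] of a cluster point. *)
Lemma enorm_bounded_cvg_subseq {R : realType} {d : nat}
    (z : nat -> 'rV[R]_d) (M : R) :
  (forall n, enorm (z n) <= M) ->
  exists (s : nat -> nat) (p : 'rV[R]_d),
    (forall k, (k <= s k)%N) /\ z (s k) @[k --> \oo] --> p.
Proof.
move=> zM.
have cK : compact [set v : 'rV[R]_d | forall i, `[- M, M]%classic (v ord0 i)].
  by apply: (@rV_compact _ _ (fun=> `[- M, M]%classic)) => i; exact: segment_compact.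
have [|p [_ clp]] := cK (z n @[n --> \oo]) _.
  exists 0%N => // n _ i /=; rewrite in_itv/= -ler_norml.
  exact: le_trans (coord_le_enorm _ _) (zM n).
have nearp (k : nat) : exists n, (k <= n)%N /\ `|p - z n| < k.+1%:R^-1.
  have [|| _ [[n /= kn <-] pn]] :=
    clp [set z n | n in [set n | (k <= n)%N]] (ball p k.+1%:R^-1).
  - by exists k => // n /= kn; exists n.
  - by apply: nbhsx_ballx; rewrite invr_gt0.
  by exists n; split => //; move: pn; rewrite -ball_normE.
have [s sP] := choice nearp.
exists s, p; split=> [k|]; first by have [] := sP k.
apply/cvgrPdist_lt => e e0.
have /cvgrPdist_lt/(_ e e0) := @cvg_harmonic R.
apply: filterS => k; rewrite sub0r normrN ger0_norm ?invr_ge0// => ke.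
by have [_ /lt_trans] := sP k; exact.
Qed.

Lemma lsc_le_cvg {X : topologicalType} {R : realType} (g : X -> \bar R)
    (x : nat -> X) (p : X) (c : nat -> R) (l : R) :
  lower_semicontinuous g -> x k @[k --> \oo] --> p -> c k @[k --> \oo] --> l ->
  (forall k, (g (x k) <= (c k)%:E)%E) -> (g p <= l%:E)%E.
Proof.
move=> glsc xp cl gxc; rewrite leNgt; apply/negP => lgp.
have [r lr rgp] : exists2 r : R, l < r & (r%:E < g p)%E.
  move: lgp; case: (g p) => [y| |] //=.
  - rewrite lte_fin => ly; exists ((l + y) / 2); rewrite ?lte_fin; lra.
  - by move=> _; exists (l + 1); rewrite ?ltry// ltrDl.
have [V Vp rV] := glsc p r rgp.
have xV : \forall k \near \oo, V (x k) by exact: xp.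
have cr : \forall k \near \oo, c k < r by exact: (cvgr_lt _ cl).
have [k [Vk ck]] := filter_ex (filterI xV cr).
have := lt_le_trans (rV _ Vk) (gxc k); rewrite lte_fin => /lt_trans/(_ ck).
by rewrite ltxx.
Qed.

(** * The proximal map *)

Section Prox.
Context {R : realType} {d : nat}.
Variable g : 'rV[R]_d -> \bar R.
Hypothesis g_convex : econvex g.
Hypothesis g_proper : proper_function g.
Implicit Types u v x : 'rV[R]_d.

Lemma econvex_fin x v (r y t : R) : g x = r%:E -> g v = y%:E ->
  0 <= t -> t <= 1 ->
  exists2 w, g (t *: v + (1 - t) *: x) = w%:E & w <= t * y + (1 - t) * r.
Proof.
move=> gx gv t0 t1.
have : (g (t *: v + (1 - t) *: x) <= t%:E * g v + (1 - t)%:E * g x)%E.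
  exact: (g_convex (Itv01 t0 t1) v x).
rewrite gx gv -!EFinM -EFinD.
have := g_proper.1 (t *: v + (1 - t) *: x).
by case: (g _) => [w _|//|//]; rewrite lee_fin => ?; exists w.
Qed.

Lemma proper_fin : exists u r, g u = r%:E.
Proof.
have [gNy [u gu]] := g_proper.
by have := gNy u; move: gu; case E: (g u) => [r| |]// _ _; exists u, r.
Qed.

(** Compare [x] with [x + t *: (v - x)]: convexity makes the [g] part at most linear in [t], and [q]
    has slope [c] up to a quadratic error. The conclusion says that [- b^-1 *: c] is a subgradient
    of [g] at [x]. *)
Lemma argmin_optimality (q B : 'rV[R]_d -> R) (b : R) x (c : 'rV[R]_d) :
  0 < b -> argmin (fun u => (q u)%:E + b%:E * g u)%E x ->
  (forall t h, 0 < t -> t <= 1 ->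
    q (x + t *: h) <= q x + t * dot c h + t ^+ 2 * B h) ->
  exists2 r, g x = r%:E &
    forall v y, g v = y%:E -> b * r <= b * y + dot c (v - x).
Proof.
move=> b0 xmin qle; have [u [ru gu]] := proper_fin.
have [r gx] : exists r, g x = r%:E.
  have := xmin u; rewrite gu -EFinM -EFinD.
  have := g_proper.1 x; case: (g x) => [r _ _|_|//]; first by exists r.
  by rewrite gt0_muley ?lte_fin// addey.
exists r => // v y gv.
suff : 0 <= dot c (v - x) + b * (y - r) by lra.
apply: (@ge0_of_quadratic _ _ (B (v - x))) => t t0 t1.
have [w gw wle] := econvex_fin x v r y t gx gv (ltW t0) t1.
have := qle t (v - x) t0 t1.
have E : t *: v + (1 - t) *: x = x + t *: (v - x).
  by rewrite scalerBl scale1r scalerBr addrCA.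
have := xmin (x + t *: (v - x)); rewrite -E gw gx -!EFinM -!EFinD lee_fin E.
nra.
Qed.

Hypothesis g_lsc : lower_semicontinuous g.

(** Direct method: the affine minorant of [g] bounds the objective below, a minimizing sequence is
    bounded, and lower semicontinuity passes to a limit point. *)
Lemma argmin_prox_nonempty (b : R) (a c : 'rV[R]_d) (gamma : R) : 0 < b ->
  (forall v y, g v = y%:E -> gamma + dot c v <= y) ->
  argmin (fun u => (2^-1 * enorm (u - a) ^+ 2)%:E + b%:E * g u)%E !=set0.
Proof.
move=> b0 gminor.
pose q u := 2^-1 * enorm (u - a) ^+ 2.
pose E := [set y : R | exists u r, g u = r%:E /\ y = q u + b * r].
have [u0 [r0 gu0]] := proper_fin.
have infE : has_inf E.
  split; first by exists (q u0 + b * r0), u0, r0.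
  (* The minimum over [u] of the objective with [g] replaced by its affine minorant, found by
     completing the square at [u - a = - b *: c]. *)
  exists (b * gamma + b * dot c a - b ^+ 2 / 2 * dot c c) => _ [u [r [gu ->]]].
  have := dot_ge0 (u - a + b *: c); rewrite /q sqr_enorm.
  have := gminor _ _ gu.
  have -> : dot c u = dot c (u - a) + dot c a by rewrite -dotDr subrK.
  move: (u - a) => w; rewrite !dotE (dotC w c) => gw.
  have := ler_wpM2l (ltW b0) gw; lra.
have infle u r : g u = r%:E -> inf E <= q u + b * r.
  by move=> gu; apply: ge_inf; [exact: infE.2|exists u, r].
have minseq (n : nat) : exists ur : 'rV[R]_d * R,
    g ur.1 = ur.2%:E /\ q ur.1 + b * ur.2 < inf E + n.+1%:R^-1.
  have n0 : 0 < n.+1%:R^-1 :> R by rewrite invr_gt0.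
  by have [_ [u [r [gu ->]]] lt] := inf_adherent n0 infE; exists (u, r).
have [ur urP] := choice minseq.
pose U n := (ur n).1.
(* By the parallelogram identity at the midpoint of [U n] and [U 0],
   [|U n - U 0|^2 <= 8]. *)
have Ubnd n : enorm (U n) <= enorm (U 0%N) + 3.
  rewrite -{1}[U n](subrK (U 0%N)) addrC.
  apply: le_trans (ler_enormD _ _) _; rewrite lerD2l.
  rewrite -[3]ger0_norm// -[enorm _]ger0_norm ?enorm_ge0// -ler_sqr ?nnegrE//.
  have [gn qn] := urP n; have [g0 q0] := urP 0%N.
  have [|| w gw wle] := econvex_fin _ _ _ _ (2^-1) g0 gn; try lra.
  have := infle _ _ gw; rewrite /q.
  have n1 : n.+1%:R^-1 <= 1 :> R by rewrite invf_le1// ler1n.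
  move: qn q0 wle; rewrite invr1 /q !real_normK ?ger0_real ?enorm_ge0//.
  rewrite -/(U n) -/(U 0%N) !sqr_enorm.
  set x := U n; set y := U 0%N.
  have -> : 2^-1 *: x + (1 - 2^-1) *: y - a = 2^-1 *: (x - a + (y - a)).
    rewrite (_ : 1 - 2^-1 = 2^-1); last lra.
    rewrite scalerDr !scalerBr addrACA -[in RHS]opprD -scalerDl.
    by rewrite (_ : 2^-1 + 2^-1 = 1) ?scale1r//; lra.
  have -> : x - y = (x - a) - (y - a) by rewrite opprB addrA subrK.
  move: (x - a) (y - a) => {}x {}y; rewrite !dotE (dotC y x) => qn q0 wle.
  have := ler_wpM2l (ltW b0) wle.
  by move: n.+1%:R^-1 n1 qn => n' n1 qn; lra.
have [s [p [ks Usp]]] := enorm_bounded_cvg_subseq U _ Ubnd.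
have qc : q (U (s k)) @[k --> \oo] --> q p.
  rewrite /q; under eq_fun do rewrite sqr_enorm; rewrite sqr_enorm.
  by apply: cvgMl_tmp; apply: cvg_dot; apply: cvgB => //; exact: cvg_cst.
have hc : (s k).+1%:R^-1 @[k --> \oo] --> (0 : R).
  exact: (cvg_comp s _ (cvg_infty_ge s ks) (@cvg_harmonic R)).
(* The near-minimality bound is solved for [g (U (s k))]; the [0] is the limit of the slack
   [(s k).+1%:R^-1]. *)
have gp : (g p <= (b^-1 * (inf E + 0 - q p))%:E)%E.
  apply: (lsc_le_cvg g (fun k => U (s k)) p
    (fun k => b^-1 * (inf E + (s k).+1%:R^-1 - q (U (s k)))) _ g_lsc Usp).
    by apply: cvgMl_tmp; apply: cvgB => //; apply: cvgD => //; exact: cvg_cst.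
  move=> k; have [gk qk] := urP (s k); rewrite gk lee_fin.
  rewrite ler_pdivlMl// -/(U _); move: qk; rewrite -/(U _).
  by move: (s k).+1%:R^-1 => n'; lra.
exists p => v /=.
have [r gpr] : exists r, g p = r%:E.
  by move: gp; have := g_proper.1 p; case: (g p) => [r|//|//]; exists r.
have := g_proper.1 v; case gv: (g v) => [y| |//] _; last first.
  by rewrite gt0_muley ?lte_fin// addey// leey.
rewrite gpr -!EFinM -!EFinD lee_fin.
apply: le_trans (infle _ _ gv).
move: gp; rewrite gpr lee_fin ler_pdivlMl// /q; lra.
Qed.

(** Nonemptiness makes [get] return a true minimizer, and the half squared distance expands exactly
    with slope [prox b g a - a]. *)
Lemma prox_optimality (b : R) (a c : 'rV[R]_d) (gamma : R) : 0 < b ->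
  (forall v y, g v = y%:E -> gamma + dot c v <= y) ->
  exists2 r, g (prox b g a) = r%:E & forall v y, g v = y%:E ->
    b * r <= b * y + dot (prox b g a - a) (v - prox b g a).
Proof.
move=> b0 gminor.
have pmin := getPex (argmin_prox_nonempty b a c gamma b0 gminor).
apply: (argmin_optimality _ (fun h => 2^-1 * dot h h) _ _ _ b0 pmin).
move=> t h t0 t1; rewrite -/(prox b g a) !sqr_enorm addrAC.
move: (prox b g a - a) => w; rewrite !dotE (dotC h w); lra.
Qed.

End Prox.

(** * Quasi-Fejer monotonicity *)

Section SummablePerturbation.
Context {R : realType}.
Implicit Types s e G : nat -> R.

Lemma nneg_series_cvg e (C : R) : (forall n, 0 <= e n) ->
  (forall n, series e n <= C) -> cvgn (series e).
Proof.
move=> e0 eC; apply: nondecreasing_is_cvgn; last by exists C => _ [n _ <-].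
apply/nondecreasing_seqP => n.
by rewrite /series /= big_nat_recr//= lerDl.
Qed.

(** Subtracting the partial sums of [e] leaves a nonincreasing sequence, bounded below by minus the
    total sum. *)
Lemma quasi_decreasing_cvg s e : (forall n, 0 <= s n) -> (forall n, 0 <= e n) ->
  cvgn (series e) -> (forall n, s n.+1 <= s n + e n) -> cvgn s.
Proof.
move=> s0 e0 ce ss.
have -> : s = (s \- series e) \+ series e by apply/funext => n /=; rewrite subrK.
apply: is_cvgD => //; apply: nonincreasing_is_cvgn.
  apply/nonincreasing_seqP => n /=.
  rewrite /series /= big_nat_recr//=.
  by move: (ss n); move: (\sum_(0 <= k < n) e k) => S; lra.
have nde : nondecreasing_seq (series e).
  by apply/nondecreasing_seqP => n; rewrite /series /= big_nat_recr//= lerDl.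
exists (- limn (series e)) => _ [n _ <-] /=.
by have := nondecreasing_cvgn_le nde ce n; have := s0 n; lra.
Qed.

Lemma quasi_decreasing_gap_cvg0 s e G : (forall n, 0 <= s n) ->
  (forall n, 0 <= e n) -> (forall n, 0 <= G n) -> cvgn (series e) ->
  (forall n, s n.+1 + G n <= s n + e n) -> G n @[n --> \oo] --> 0.
Proof.
move=> s0 e0 G0 ce sG.
have cs : cvgn s.
  by apply: (quasi_decreasing_cvg s e) => // n; move: (sG n) (G0 n); lra.
have se0 : s n - s n.+1 + e n @[n --> \oo] --> (0 : R).
  have cs1 : s n.+1 @[n --> \oo] --> limn s by rewrite (cvg_shiftS s).
  have := cvgD (cvgB cs cs1) (cvg_series_cvg_0 ce).
  by rewrite subrr addr0; exact.
apply: (squeeze_cvgr _ (cvg_cst 0) se0).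
by apply: nearW => n; rewrite G0/=; move: (sG n); lra.
Qed.

End SummablePerturbation.

(** * Null sequences in the Euclidean norm and in the library topology *)

Section EuclideanLimits.
Context {R : realType} {d : nat}.
Implicit Types z : nat -> 'rV[R]_d.

Lemma cvg0_enorm z : enorm (z n) @[n --> \oo] --> (0 : R) ->
  z n @[n --> \oo] --> (0 : 'rV[R]_d).
Proof.
move=> z0; apply/norm_cvg0P.
apply: (squeeze_cvgr _ (cvg_cst 0) z0).
by apply: nearW => n; rewrite normr_ge0 norm_le_enorm.
Qed.

Lemma cvg0_dot z : dot (z n) (z n) @[n --> \oo] --> (0 : R) ->
  z n @[n --> \oo] --> (0 : 'rV[R]_d).
Proof.
move=> z0; apply: cvg0_enorm; under eq_fun do rewrite enormE.
by have := cvg_comp _ _ z0 (@sqrt_continuous R 0); rewrite sqrtr0; exact.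
Qed.

Lemma enorm_cvg0 z : z n @[n --> \oo] --> (0 : 'rV[R]_d) ->
  enorm (z n) @[n --> \oo] --> (0 : R).
Proof.
move=> z0; under eq_fun do rewrite enormE.
have dot00 : dot (0 : 'rV[R]_d) 0 = 0 by rewrite -(scale0r 0) dotZl mul0r.
have sqrt0 := @sqrt_continuous R 0; rewrite /continuous_at sqrtr0 in sqrt0.
by apply: cvg_comp sqrt0; rewrite -dot00; exact: cvg_dot.
Qed.

End EuclideanLimits.

(** * The perturbed forward-backward iteration *)

(** Put [X = x - p], [W = w - p], [Z = X - alpha *: G]. Cocoercivity gives [dot Z Z + alpha * (2 / L
    - alpha) * dot G G <= dot X X], and the last hypothesis reads [dot W W <= dot (Z + e) W].
    Cauchy-Schwarz gives the first bound, expanding the square of [Z + e - W] the second. *)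
Lemma forward_backward_step {R : realType} {d : nat} (alpha L : R)
    (x w p G e : 'rV[R]_d) :
  0 < alpha -> 0 < L -> alpha < 2 / L ->
  L^-1 * dot G G <= dot G (x - p) ->
  0 <= dot (x - w - alpha *: G + e) (w - p) ->
  enorm (w - p) <= enorm (x - p) + enorm e /\
  dot (w - p) (w - p) + (alpha * (2 / L - alpha) * dot G G
    + dot (x - w - alpha *: G + e) (x - w - alpha *: G + e))
  <= dot (x - p) (x - p) + (2 * enorm (x - p) * enorm e + enorm e ^+ 2).
Proof.
move=> a0 L0 aL; have -> : x - w = (x - p) - (w - p) by rewrite opprB addrA subrK.
move: (x - p) (w - p) => X W coco.
pose Z := X - alpha *: G.
have -> : X - W - alpha *: G + e = Z + e - W.
  by rewrite /Z [X - W - _]addrAC [LHS]addrAC.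
have ZX : dot Z Z + alpha * (2 / L - alpha) * dot G G <= dot X X.
  have := ler_wpM2l (ltW a0) coco.
  by rewrite /Z !dotE (dotC X G); move: L^-1 => L'; lra.
clearbody Z.
have ZX' : enorm Z <= enorm X.
  rewrite -ler_sqr ?nnegrE ?enorm_ge0// !sqr_enorm; apply: le_trans ZX.
  by rewrite lerDl !mulr_ge0 ?dot_ge0 ?(ltW a0)// subr_ge0 ltW.
have Ze : dot (Z + e) (Z + e) <= dot Z Z + 2 * enorm X * enorm e + enorm e ^+ 2.
  rewrite sqr_enorm !dotE (dotC e Z).
  have := dot_le_enorm Z e; have := ler_wpM2r (enorm_ge0 e) ZX'; lra.
rewrite [dot _ W]dotDl dotNl => ZeW; split.
  have WZe : enorm W <= enorm (Z + e).
    have [->|W0] := eqVneq (enorm W) 0; first exact: enorm_ge0.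
    have W_gt0 : 0 < enorm W by rewrite lt_def W0 enorm_ge0.
    rewrite -(ler_pM2r W_gt0) -expr2 sqr_enorm.
    by have := dot_le_enorm (Z + e) W; lra.
  by have := ler_enormD Z e; lra.
rewrite [dot (_ - W) _]dotDl dotNl ![dot _ (_ - W)]dotDr !dotNr (dotC W (Z + e)).
lra.
Qed.

Lemma cvg_upper_bound {R : realType} (s : nat -> R) :
  cvgn s -> exists2 M, 0 <= M & forall n, s n <= M.
Proof.
move=> /cvg_seq_bounded[M [_ Mb]].
exists (`|M| + 1) => [|n]; first by rewrite addr_ge0.
apply: le_trans (ler_norm _) (Mb _ _ n I).
by rewrite (le_lt_trans (ler_norm M))// ltrDl.
Qed.

(** * Variational characterization of the minimizers of the objective *)

Section Minimizers.
Context {R : realType} {d : nat}.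
Variables (f : 'rV[R]_d -> R) (L : R) (g : 'rV[R]_d -> \bar R) (lambda : R).
Hypothesis f_convex : convex_function [set: 'rV[R]_d] f.
Hypothesis df : forall x, differentiable f x.
Hypothesis lip : elipschitz L (gradient f).
Hypothesis g_convex : econvex g.
Hypothesis g_proper : proper_function g.
Hypothesis lambda_gt0 : 0 < lambda.

Lemma minimizer_optimality p : argmin (objective f g lambda) p ->
  exists2 r, g p = r%:E & forall v y, g v = y%:E ->
    lambda * r <= lambda * y + dot (gradient f p) (v - p).
Proof.
move=> pmin.
apply: (argmin_optimality g g_convex g_proper f (fun h => L / 2 * dot h h)) => //.
move=> t h _ _; have := descent f L df lip p (t *: h).
by rewrite !dotE; lra.
Qed.

(** Add the first-order inequality for [f] at [p]; points where [g] is infinite are trivial. *)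
Lemma optimality_minimizer p r : g p = r%:E ->
  (forall v y, g v = y%:E ->
    lambda * r <= lambda * y + dot (gradient f p) (v - p)) ->
  argmin (objective f g lambda) p.
Proof.
move=> gp opt v; rewrite /objective gp.
have := g_proper.1 v; case gv: (g v) => [y| |//] _; last first.
  by rewrite gt0_muley ?lte_fin// addey// leey.
rewrite -!EFinM -!EFinD lee_fin.
have := gradient_le f L f_convex df lip p (v - p).
rewrite [p + _]addrC subrK.
by have := opt v y gv; lra.
Qed.

End Minimizers.

(** * Fejer estimates, vanishing steps and convergence of the iterates *)

Section ForwardBackward.
Context {R : realType} {d : nat}.
Variables (f : 'rV[R]_d -> R) (L : R) (g : 'rV[R]_d -> \bar R) (lambda : R)
  (lambda_ : nat -> R) (alpha : R) (u : nat -> 'rV[R]_d).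
Hypothesis f_convex : convex_function [set: 'rV[R]_d] f.
Hypothesis f_C1 : continuously_differentiable f.
Hypothesis L_gt0 : 0 < L.
Hypothesis lip : elipschitz L (gradient f).
Hypothesis g_convex : econvex g.
Hypothesis g_proper : proper_function g.
Hypothesis g_lsc : lower_semicontinuous g.
Hypothesis lambda_gt0 : 0 < lambda.
Hypothesis F_min : argmin (objective f g lambda) !=set0.
Hypothesis lambda_n_gt0 : forall n, 0 < lambda_ n.
Hypothesis lambda_n_sum : cvgn (series (fun n => `|lambda_ n - lambda|)).
Hypothesis alpha_gt0 : 0 < alpha.
Hypothesis alpha_lt : alpha < 2 / L.
Hypothesis u_step : forall n,
  u n.+1 = prox (alpha * lambda_ n) g (u n - alpha *: gradient f (u n)).

Lemma iterate_optimality n : exists2 r, g (u n.+1) = r%:E &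
  forall v y, g v = y%:E -> alpha * lambda_ n * r <= alpha * lambda_ n * y
    + dot (u n.+1 - (u n - alpha *: gradient f (u n))) (v - u n.+1).
Proof.
have [p /(minimizer_optimality _ _ _ _ f_C1.1 lip g_convex g_proper lambda_gt0)
  [r gp opt]] := F_min.
(* The affine minorant that guarantees existence of the prox is the optimality condition at a
   minimizer [p], divided by [lambda]. *)
rewrite u_step; apply: (prox_optimality g g_convex g_proper g_lsc _ _
  (- lambda^-1 *: gradient f p) (r + lambda^-1 * dot (gradient f p) p)).
  by rewrite mulr_gt0.
move=> v y /opt; rewrite -(ler_pM2l (_ : 0 < lambda^-1)) ?invr_gt0//.
rewrite mulrDr !mulKf ?gt_eqF// !dotE; lra.
Qed.

Let err (p : 'rV[R]_d) n : 'rV[R]_d :=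
  ((lambda_ n / lambda - 1) * alpha) *: gradient f p.

Lemma enorm_err p n : enorm (err p n) =
  (lambda^-1 * alpha * enorm (gradient f p)) * `|lambda_ n - lambda|.
Proof.
rewrite enormZ (_ : _ * alpha = lambda^-1 * alpha * (lambda_ n - lambda)).
  by rewrite normrM gtr0_norm ?mulr_gt0 ?invr_gt0// mulrAC.
by field; rewrite gt_eqF.
Qed.

Lemma series_enorm_err p : cvgn (series (fun n => enorm (err p n))).
Proof.
under eq_fun do rewrite enorm_err.
exact: is_cvg_seriesZ.
Qed.

Lemma iterate_step p n : argmin (objective f g lambda) p ->
  0 <= dot (u n - u n.+1 - alpha *: (gradient f (u n) - gradient f p) + err p n)
    (u n.+1 - p).
Proof.
move/(minimizer_optimality _ _ _ _ f_C1.1 lip g_convex g_proper lambda_gt0).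
move=> [r gp opt]; have [y gu optu] := iterate_optimality n.
have := optu _ _ gp.
(* This factor gives [g] the weight [alpha * lambda_ n] in both inequalities, so that its values
   cancel in the sum. *)
have c0 : 0 < alpha * lambda_ n / lambda by rewrite !mulr_gt0 ?invr_gt0.
have := ler_wpM2l (ltW c0) (opt _ _ gu).
have scal a : alpha * lambda_ n / lambda * (lambda * a) = alpha * lambda_ n * a.
  by field; rewrite gt_eqF.
rewrite [_ * (_ + _)]mulrDr !scal.
rewrite /err -[p - _]opprB; move: (u n.+1 - p) => W.
have -> : alpha * lambda_ n / lambda = alpha * (lambda_ n / lambda - 1 + 1).
  by rewrite subrK mulrA.
move: (lambda_ n / lambda - 1) => D; rewrite !dotE.
lra.
Qed.

Lemma iterate_bounds p n : argmin (objective f g lambda) p ->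
  enorm (u n.+1 - p) <= enorm (u n - p) + enorm (err p n) /\
  dot (u n.+1 - p) (u n.+1 - p)
    + (alpha * (2 / L - alpha) * dot (gradient f (u n) - gradient f p)
                                     (gradient f (u n) - gradient f p)
      + dot (u n - u n.+1 - alpha *: (gradient f (u n) - gradient f p) + err p n)
            (u n - u n.+1 - alpha *: (gradient f (u n) - gradient f p) + err p n))
  <= dot (u n - p) (u n - p)
    + (2 * enorm (u n - p) * enorm (err p n) + enorm (err p n) ^+ 2).
Proof.
move=> pmin; apply: forward_backward_step => //.
- exact: (gradient_cocoercive f L f_convex f_C1.1 L_gt0 lip).
- exact: iterate_step.
Qed.

Lemma enorm_iterate_cvg p : argmin (objective f g lambda) p ->
  cvgn (fun n => enorm (u n - p)).
Proof.
move=> pmin; apply: quasi_decreasing_cvg (series_enorm_err p) _ => n.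
- exact: enorm_ge0.
- exact: enorm_ge0.
- by have [] := iterate_bounds p n pmin.
Qed.

Lemma enorm_iterate_bounded p : argmin (objective f g lambda) p ->
  exists2 M, 0 <= M & forall n, enorm (u n - p) <= M.
Proof. by move=> /enorm_iterate_cvg/cvg_upper_bound. Qed.

Lemma iterate_diff_cvg0 : u n.+1 - u n @[n --> \oo] --> (0 : 'rV[R]_d).
Proof.
have [p pmin] := F_min.
have [M M0 uM] := enorm_iterate_bounded p pmin.
have err0 : enorm (err p n) @[n --> \oo] --> (0 : R).
  exact: cvg_series_cvg_0 (series_enorm_err p).
have [C C0 errC] := cvg_upper_bound _ (cvgP _ err0).
pose G n := gradient f (u n) - gradient f p.
pose D n := u n - u n.+1 - alpha *: G n + err p n.
pose c := alpha * (2 / L - alpha).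
have c0 : 0 < c by rewrite mulr_gt0// subr_gt0.
have gap0 : c * dot (G n) (G n) + dot (D n) (D n) @[n --> \oo] --> (0 : R).
  (* The perturbation is made linear in [enorm (err p n)] by bounding the distances by [M] and one
     factor of the squared error by [C]. *)
  apply: (quasi_decreasing_gap_cvg0 (fun n => dot (u n - p) (u n - p))
    (fun n => (2 * M + C) * enorm (err p n))) => [n|n|n||n].
  - exact: dot_ge0.
  - by rewrite mulr_ge0 ?enorm_ge0// addr_ge0// mulr_ge0.
  - by rewrite addr_ge0 ?dot_ge0// mulr_ge0 ?dot_ge0// ltW.
  - exact: is_cvg_seriesZ (series_enorm_err p).
  - have [_ /le_trans] := iterate_bounds p n pmin; apply; rewrite lerD2l.
    have := enorm_ge0 (err p n).
    have := uM n; have := errC n; nra.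
have G0 : G n @[n --> \oo] --> (0 : 'rV[R]_d).
  apply: cvg0_dot.
  have gap0' : c^-1 * (c * dot (G n) (G n) + dot (D n) (D n))
      @[n --> \oo] --> (0 : R).
    by have := cvgMl_tmp (a := c^-1) gap0; rewrite mulr0; exact.
  apply: (squeeze_cvgr _ (cvg_cst 0) gap0'); apply: nearW => n.
  rewrite dot_ge0/= -(ler_pM2l c0) mulrA divff ?gt_eqF// mul1r lerDl.
  exact: dot_ge0.
have D0 : D n @[n --> \oo] --> (0 : 'rV[R]_d).
  apply: cvg0_dot; apply: (squeeze_cvgr _ (cvg_cst 0) gap0).
  apply: nearW => n; rewrite dot_ge0/= lerDr.
  by rewrite mulr_ge0 ?dot_ge0// ltW.
(* The definition of [D] solved for the step: all three terms tend to 0. *)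
have -> : (fun n => u n.+1 - u n) = (fun n => err p n - alpha *: G n - D n).
  apply/funext => n; rewrite /D; move: (alpha *: G n) (err p n) => a b.
  by rewrite !opprD !opprK; apply/rowP => i; rewrite !mxE; ring.
have lim0 := cvgB (cvgB (cvg0_enorm _ err0) (cvgZl_tmp (k := alpha) G0)) D0.
by move: lim0; rewrite scaler0 !subr0; exact.
Qed.

Lemma lambda_cvg : lambda_ n @[n --> \oo] --> lambda.
Proof. exact/subr_cvg0/norm_cvg0P/(cvg_series_cvg_0 lambda_n_sum). Qed.

Lemma cluster_point_minimizer (s : nat -> nat) q :
  (forall k, (k <= s k)%N) -> u (s k) @[k --> \oo] --> q ->
  argmin (objective f g lambda) q.
Proof.
move=> ks usq.
(* The prox inequality controls [g] at [u (s k).+1], so this shifted sequence must have limit [q] as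
   well. *)
have soo := cvg_infty_ge s ks.
have us1q : u (s k).+1 @[k --> \oo] --> q.
  exact: cvg_sub0 (cvg_comp s _ soo iterate_diff_cvg0) usq.
have gradq : gradient f (u (s k)) @[k --> \oo] --> gradient f q.
  exact: (cvg_comp _ _ usq (f_C1.2 q)).
have lamq := cvg_comp s _ soo lambda_cvg.
(* The prox inequality solved for [g (u (s k).+1)], in the limit; the difference in [dot] is just
   [alpha *: gradient f q]. *)
have gqle v y : g v = y%:E ->
    (g q <= (y + (alpha * lambda)^-1
      * dot (q - (q - alpha *: gradient f q)) (v - q))%:E)%E.
  move=> gv.
  apply: (lsc_le_cvg g (fun k => u (s k).+1) q (fun k =>
    y + (alpha * lambda_ (s k))^-1
      * dot (u (s k).+1 - (u (s k) - alpha *: gradient f (u (s k))))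
            (v - u (s k).+1))) => //.
    apply: cvgD; first exact: cvg_cst.
    apply: cvgM.
      by apply: cvgV; [rewrite gt_eqF// mulr_gt0|exact: cvgMl_tmp].
    apply: cvg_dot; last by apply: cvgB => //; exact: cvg_cst.
    by apply: cvgB => //; apply: cvgB => //; exact: cvgZl_tmp.
  move=> k; have [r gu optu] := iterate_optimality (s k).
  have al0 : 0 < alpha * lambda_ (s k) by rewrite mulr_gt0.
  rewrite gu lee_fin -(ler_pM2l al0) mulrDr mulVKf ?gt_eqF//.
  exact: optu.
have [v0 [y0 gv0]] := proper_fin g g_proper.
have [r gq] : exists r, g q = r%:E.
  have := gqle _ _ gv0; have := g_proper.1 q.
  by case: (g q) => [r|//|//]; exists r.
apply: (optimality_minimizer f L g lambda f_convex f_C1.1 lip g_proper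
  lambda_gt0 _ r gq).
move=> v y /gqle; rewrite gq lee_fin subKr dotZl -(ler_pM2l lambda_gt0).
by rewrite mulrDr (_ : lambda * (_ * _) = dot (gradient f q) (v - q)) //;
  field; rewrite !gt_eqF.
Qed.

Lemma forward_backward_cvg : exists uhat : 'rV[R]_d,
  argmin (objective f g lambda) uhat /\ (u n @[n --> \oo] --> uhat).
Proof.
have [p pmin] := F_min.
have [M M0 uM] := enorm_iterate_bounded p pmin.
have ubnd n : enorm (u n) <= enorm p + M.
  rewrite -{1}[u n](subrK p) addrC.
  by apply: le_trans (ler_enormD _ _) _; rewrite lerD2l.
have [s [q [ks usq]]] := enorm_bounded_cvg_subseq u _ ubnd.
have qmin := cluster_point_minimizer s q ks usq.
exists q; split => //.
have cq := enorm_iterate_cvg q qmin.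
have sub0 : enorm (u (s k) - q) @[k --> \oo] --> (0 : R).
  exact/enorm_cvg0/subr_cvg0.
have lim0 : limn (fun n => enorm (u n - q)) = 0.
  exact: (cvg_unique _ (cvg_comp s _ (cvg_infty_ge s ks) cq) sub0).
by apply/subr_cvg0/cvg0_enorm; rewrite -lim0.
Qed.

End ForwardBackward.

Theorem theorem1 (R : realType) (d : nat)
  (f : 'rV[R]_d -> R) (L : R) (g : 'rV[R]_d -> \bar R) (lambda : R)
  (lambda_ : nat -> R) (alpha : R) (u0 : 'rV[R]_d) (u : nat -> 'rV[R]_d)
  (f_convex : convex_function [set: 'rV[R]_d] f)
  (f_C1 : continuously_differentiable f)
  (L_gt0 : 0 < L)
  (gradf_lip : elipschitz L (gradient f))
  (g_convex : econvex g)
  (g_proper : proper_function g)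
  (g_lsc : lower_semicontinuous g)
  (lambda_gt0 : 0 < lambda)
  (F_min : argmin (objective f g lambda) !=set0)
  (lambda_n_gt0 : forall n, 0 < lambda_ n)
  (lambda_n_sum : (\sum_(0 <= n <oo) (`|lambda_ n - lambda|%R)%:E < +oo)%E)
  (alpha_gt0 : 0 < alpha)
  (alpha_lt : alpha < 2 / L)
  (u_init : u 0%N = u0)
  (u_step : forall n,
     u n.+1 = prox (alpha * lambda_ n) g (u n - alpha *: gradient f (u n))) :
  exists uhat : 'rV[R]_d,
    argmin (objective f g lambda) uhat /\ (u n @[n --> \oo] --> uhat).
Proof.
apply: (forward_backward_cvg f L g lambda lambda_ alpha) => //.
(* Finiteness of the extended sum makes its [fine] part a real bound on all partial sums. *)
have lim_real : (\sum_(0 <= n <oo) (`|lambda_ n - lambda|%R)%:E)%E \is a fin_num.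
  by rewrite ge0_fin_numE// nneseries_ge0.
apply: (nneg_series_cvg _
  (fine (\sum_(0 <= n <oo) (`|lambda_ n - lambda|%R)%:E)%E)) => // n.
rewrite -lee_fin fineK// /series /= -sumEFin.
exact: nneseries_lim_ge.
Qed.
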